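(* Let $S$ be a Hermitian positive definite $n\times n$ matrix, let $m\ge 1$ be an integer, and let $$g_m(Z) = Z \sum_{k=0}^m b_k(I-Z^*SZ)^k$$ on $n\times n$ matrices. Let $Z$ satisfy $Z^*SZ=I$ (so that $Z=g_m(Z)$). Then the Fréchet derivative of $g_m$ at $Z$ in direction $E$ is $$L_{g_m}(Z;E) = \tfrac{1}{2}(E-ZE^*SZ),$$ and it is idempotent, i.e. $L_{g_m}(Z;L_{g_m}(Z;E)) = L_{g_m}(Z;E)$ for all $E$. Consequently the iteration $Z_{i+1}=g_m(Z_i)$ is stable in a neighborhood of the fixed point $Z$.
   Context: Matrices are complex and $^*$ denotes the conjugate transpose. The coefficients are $b_0 = 1$, $b_k = \frac{2k-1}{2k}b_{k-1}$ for $k=1,\dots,m$. The Fréchet derivative $L_f(X;E)$ of a matrix function $f$ at $X$ in direction $E$ is the mapping, linear in $E$ (over the real numbers), satisfying $L_f(X;E)=f(X+E)-f(X)+o(\|E\|)$ for all $E$. $L_f^p(X;E)$ denotes $p$-fold composition of the Fréchet derivative in the second argument, e.g. $L_f^2(X;E)=L_f(X;L_f(X;E))$. A matrix iteration $X_{i+1}=f(X_i)$ is called stable in a neighborhood of a fixed point $X=f(X)$ if $L_f(X;E)$ exists at $X$ and there is a constant $c$ such that $\max_{E\ne 0}\|L_f^p(X;E)\|/\|E\|\le c$ for every integer $p>0$. *)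

(* Defs.v *)
From mathcomp Require Import all_boot all_order all_algebra complex.
From mathcomp Require Import boolp classical_sets reals.

Set Implicit Arguments.
Unset Strict Implicit.
Unset Printing Implicit Defensive.

Import Order.TTheory GRing.Theory Num.Theory.

Local Open Scope ring_scope.
Local Open Scope sesquilinear_scope.
Local Open Scope complex_scope.
Local Open Scope classical_set_scope.

(* [M ^t*] is the conjugate transpose of M, and [hermsymmx] is the set of     *)
(* matrices equal to their conjugate transpose.                               *)
Definition hermitian_posdef (R : realType) (n : nat) (S : 'M[R[i]]_n) : Prop :=
  S \is hermsymmx /\
  forall x : 'cV[R[i]]_n, x != 0 -> 0 < (x ^t* *m S *m x) ord0 ord0.

Fixpoint b (R : realType) (k : nat) : R[i] :=
  if k is k'.+1 then (2 * k%:R - 1) / (2 * k%:R) * b R k' else 1.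

(* For square matrices [^+] is the matrix power; it is available for every    *)
(* size n, including 0.                                                       *)
Definition g (R : realType) (n : nat) (S : 'M[R[i]]_n) (m : nat)
    (Z : 'M[R[i]]_n) : 'M[R[i]]_n :=
  Z *m \sum_(0 <= k < m.+1) b R k *: (1%:M - Z ^t* *m S *m Z) ^+ k.

(* An arbitrary vector norm on complex matrices. The modulus [`|a|] has       *)
(* type R[i] in the library, so homogeneity is stated in R[i].                *)
Record is_matrix_norm (R : realType) (n : nat) (N : 'M[R[i]]_n -> R) : Prop :=
  IsMatrixNorm {
    matrix_norm_eq0 : forall E, N E = 0 -> E = 0;
    matrix_normZ : forall (a : R[i]) E, (N (a *: E))%:C = `|a| * (N E)%:C;
    matrix_normD : forall E F, N (E + F) <= N E + N F
  }.

(* Linearity is over R only: E |-> E^* is not linear over R[i], so the        *)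
(* library's differential over the scalar field R[i] is not applicable.       *)
Definition real_linear (R : realType) (n : nat)
    (L : 'M[R[i]]_n -> 'M[R[i]]_n) : Prop :=
  forall (a : R) E F, L (a%:C *: E + F) = a%:C *: L E + L F.

(* L E = f (X + E) - f X + o(N E) as E tends to 0, with L linear over R. *)
Definition is_frechet (R : realType) (n : nat) (N : 'M[R[i]]_n -> R)
    (f : 'M[R[i]]_n -> 'M[R[i]]_n) (X : 'M[R[i]]_n)
    (L : 'M[R[i]]_n -> 'M[R[i]]_n) : Prop :=
  real_linear L /\
  forall e : R, 0 < e -> exists2 d : R, 0 < d &
    forall E, N E < d -> N (f (X + E) - f X - L E) <= e * N E.

Definition frechet_differentiable (R : realType) (n : nat)
    (N : 'M[R[i]]_n -> R) (f : 'M[R[i]]_n -> 'M[R[i]]_n) (X : 'M[R[i]]_n) :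
    Prop :=
  exists L, is_frechet N f X L.

(* The Frechet derivative L_f(X; -), with the junk value 0 when it does not   *)
(* exist.                                                                     *)
Definition frechet (R : realType) (n : nat) (N : 'M[R[i]]_n -> R)
    (f : 'M[R[i]]_n -> 'M[R[i]]_n) (X : 'M[R[i]]_n) :
    'M[R[i]]_n -> 'M[R[i]]_n :=
  xget (fun=> 0) [set L | is_frechet N f X L].

(* Stability of the iteration X_(i+1) = f X_i in a neighborhood of the fixed  *)
(* point X; [iter p (frechet N f X)] is L_f^p(X; -).                          *)
Definition stable_iteration (R : realType) (n : nat) (N : 'M[R[i]]_n -> R)
    (f : 'M[R[i]]_n -> 'M[R[i]]_n) (X : 'M[R[i]]_n) : Prop :=
  [/\ f X = X,
      frechet_differentiable N f X &
      exists c : R, forall p : nat, (0 < p)%N ->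
        forall E, E != 0 -> N (iter p (frechet N f X) E) / N E <= c].

(* Main.v *)
Require Import Defs.
From mathcomp Require Import all_boot all_order all_algebra complex.
From mathcomp Require Import boolp classical_sets reals.
From mathcomp Require Import topology normedtype derive ring.

(* On matrices all norms are equivalent, so every estimate can be made in the *)
(* submultiplicative norm [entry_norm], the sum of the moduli of the entries. *)
(* At the fixed point the defect D = I - (Z + E)^* S (Z + E) is O(|E|), so    *)
(* g (Z + E) = (Z + E) (I + D / 2) + O(|E|^2), and Z Z^* S = I turns the      *)
(* first-order part into (E - Z E^* S Z) / 2. With P E := Z E^* S Z one has   *)
(* P (P E) = E, hence (E - P E) / 2 is idempotent, and all its iterates are   *)
(* bounded by its own operator norm.                                          *)

Set Implicit Arguments.
Unset Strict Implicit.
Unset Printing Implicit Defensive.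
Import Order.TTheory GRing.Theory Num.Theory.
Import numFieldNormedType.Exports Normc.
Local Open Scope ring_scope.
Local Open Scope sesquilinear_scope.
Local Open Scope complex_scope.

(** The [b R k] are the Taylor coefficients of (1 - x)^(-1/2), so [g] truncates Z (Z^* S Z)^(-1/2),
    and only b_0 = 1 and b_1 = 1/2 influence the derivative at a fixed point. The exact identity
    [g_remainderE] exhibits the remainder as a sum of terms of order at least 2 in E, and
    [g_is_frechet] concludes from it. With P the real-linear involution of the outline above, the
    derivative is the projection of the matrix space onto the -1 eigenspace of P along the +1
    eigenspace ([g_derivative_idem]). Two further points link this algebra to the statement. The
    norm [N] is arbitrary, so [matrix_norm_le_entry_norm] and [entry_norm_le_matrix_norm] carry
    estimates to and from [entry_norm]. And [frechet] is defined by choice, so [is_frechet_unique]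
    is what identifies it with the explicit formula. *)

(** * Norms on real row vectors *)

Lemma rV_entry_le_norm (R : realType) (k : nat) (v : 'rV[R]_k) j :
  `|v ord0 j| <= `|v|.
Proof.
rewrite [leRHS]/Num.norm /= mx_normrE.
exact: (le_bigmax _ (fun ij => `|v ij.1 ij.2|) (ord0, j)).
Qed.

(* The minimum of [p] over the compact unit sphere is positive. *)
Lemma rV_norm_lower_bound (R : realType) (k : nat) (p : 'rV[R]_k -> R) :
    (forall v, p v = 0 -> v = 0) ->
    (forall a v, p (a *: v) = `|a| * p v) ->
    (forall u v, p (u + v) <= p u + p v) ->
  exists2 C : R, 0 < C & forall v, `|v| <= C * p v.
Proof.
move=> p_eq0 pZ pD.
have p0 : p 0 = 0 by rewrite -(scale0r (0 : 'rV[R]_k)) pZ normr0 mul0r.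
have pN v : p (- v) = p v by rewrite -scaleN1r pZ normrN1 mul1r.
have p_ge0 v : 0 <= p v.
  by have := pD v (- v); rewrite pN subrr p0 -mulr2n pmulrn_lge0.
have p_sum (I : finType) (F : I -> 'rV[R]_k) :
    p (\sum_i F i) <= \sum_i p (F i).
  elim/big_ind2: _ => [|u a v c ua vc|//]; first by rewrite p0.
  by rewrite (le_trans (pD _ _)) ?lerD.
(* The summand 1 keeps [M] positive even when k = 0. *)
pose M := 1 + \sum_(j < k) p (delta_mx ord0 j).
have M_gt0 : 0 < M by rewrite ltr_pwDl ?sumr_ge0.
have p_le v : p v <= M * `|v|.
  rewrite {1}[v]row_sum_delta (le_trans (p_sum _ _)) // mulrDl mul1r.
  rewrite mulr_suml ler_wpDl // ler_sum // => j _.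
  by rewrite pZ mulrC ler_wpM2l ?rV_entry_le_norm.
(* [p] is Lipschitz: |p u - p v| <= p (u - v) <= M |u - v|. *)
have p_cont : continuous p.
  move=> u; apply/(@cvgrPdist_lt _ _ _ (nbhs u)) => /= e e0; apply/nbhs_ballP.
  exists (e / M) => /= [|v]; first by rewrite divr_gt0.
  rewrite -ball_normE /= => uv.
  apply: (@le_lt_trans _ _ (p (u - v))); last first.
    by rewrite (le_lt_trans (p_le _)) // mulrC -ltr_pdivlMr.
  have p_sub w z : p w <= p (w - z) + p z by rewrite -{1}(subrK z w).
  rewrite ler_norml lerBlDr p_sub andbT lerNl opprB lerBlDr.
  by rewrite -(pN (u - v)) opprB.
pose A := [set v : 'rV[R]_k | `|v| = 1]%classic.
(* If the sphere is empty, the space is zero and any constant works. *)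
have [A0|/set0P A0] := eqVneq A set0%classic.
  exists 1 => // v; rewrite mul1r; have [->|v0] := eqVneq v 0.
    by rewrite normr0.
  have : A (`|v|^-1 *: v).
    by rewrite /A /= normrZ normfV normr_id mulVf ?normr_eq0.
  by rewrite A0.
have A_compact : compact A.
  apply: bounded_closed_compact.
    by exists 1; split; rewrite ?num_real // => x x1 v /= ->; exact: ltW.
  by apply: (@preimage_closed _ _ (fun v : 'rV[R]_k => `|v|) [set 1]%classic);
    [move=> v _; exact: norm_continuous|exact: closed_eq].
have [v0 v0A v0_min] := EVT_min_rV A0 A_compact (continuous_subspaceT p_cont).
have pv0 : 0 < p v0.
  rewrite lt0r p_ge0 andbT; apply/eqP => /p_eq0 v00.
  by move: v0A; rewrite inE /A /= v00 normr0 => /esym/eqP; rewrite oner_eq0.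
exists (p v0)^-1 => [|v]; first by rewrite invr_gt0.
have [->|vn0] := eqVneq v 0; first by rewrite normr0 p0 mulr0.
rewrite mulrC ler_pdivlMr // mulrC -ler_pdivlMr ?normr_gt0 // mulrC.
rewrite -[X in X * _]ger0_norm ?invr_ge0 // -pZ v0_min // inE /A /=.
by rewrite normrZ normfV normr_id mulVf ?normr_eq0.
Qed.

(** * The submultiplicative entrywise norm *)

Definition entry_norm (R : realType) (n : nat) (A : 'M[R[i]]_n) : R :=
  \sum_i \sum_j normc (A i j).

Lemma normc_ge0 (R : rcfType) (z : R[i]) : 0 <= normc z.
Proof. by case: z => a b; exact: sqrtr_ge0. Qed.

Lemma normc_real (R : rcfType) (a : R) : normc a%:C = `|a|.
Proof. by rewrite /= expr0n addr0 sqrtr_sqr. Qed.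

Lemma normc_conj (R : rcfType) (z : R[i]) : normc (Num.conj z) = normc z.
Proof. by apply: complexI; exact: norm_conjC. Qed.

Lemma normc_le_ReD_Im (R : rcfType) (z : R[i]) :
  normc z <= `|complex.Re z| + `|complex.Im z|.
Proof.
case: z => a b /=; rewrite -[leRHS]ger0_norm ?addr_ge0 // -(sqrtr_sqr (_ + _)).
rewrite ler_wsqrtr // sqrrD !real_normK ?num_real // -addrAC lerDl.
by rewrite mulrn_wge0 ?mulr_ge0.
Qed.

Section EntryNorm.
Variables (R : realType) (n : nat).
Implicit Types A B : 'M[R[i]]_n.

Lemma entry_norm_ge0 A : 0 <= entry_norm A.
Proof. by apply: sumr_ge0 => i _; apply: sumr_ge0 => j _; exact: normc_ge0. Qed.

Lemma entry_normD A B : entry_norm (A + B) <= entry_norm A + entry_norm B.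
Proof.
rewrite -big_split ler_sum // => i _; rewrite -big_split ler_sum // => j _.
by rewrite mxE le_normcD.
Qed.

Lemma entry_normZ (a : R[i]) A : entry_norm (a *: A) = normc a * entry_norm A.
Proof.
rewrite mulr_sumr; apply: eq_bigr => i _; rewrite mulr_sumr.
by apply: eq_bigr => j _; rewrite mxE normcM.
Qed.

Lemma entry_norm_trC A : entry_norm (A ^t*) = entry_norm A.
Proof.
rewrite /entry_norm exchange_big; apply: eq_bigr => i _; apply: eq_bigr => j _.
by rewrite !mxE normc_conj.
Qed.

Lemma normc_sum (I : finType) (F : I -> R[i]) :
  normc (\sum_i F i) <= \sum_i normc (F i).
Proof.
elim/big_ind2: _ => [|u a v c ua vc|//]; first by rewrite normc0.
by rewrite (le_trans (le_normcD _ _)) ?lerD.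
Qed.

(** After the triangle inequality and an exchange of sums, each |A i k| is multiplied by the sum
    over row k of B, which is at most the whole norm of B. *)
Lemma entry_normM A B : entry_norm (A *m B) <= entry_norm A * entry_norm B.
Proof.
rewrite mulr_suml ler_sum // => i _.
have rowB_le k : \sum_j normc (B k j) <= entry_norm B.
  rewrite /entry_norm [leRHS](bigD1 k) //= lerDl.
  by apply: sumr_ge0 => l _; apply: sumr_ge0 => j _; exact: normc_ge0.
apply: (@le_trans _ _ (\sum_j \sum_k normc (A i k) * normc (B k j))).
  apply: ler_sum => j _; rewrite mxE.
  rewrite (le_trans (normc_sum _)) // ler_sum // => k _.
  by rewrite normcM.
rewrite exchange_big mulr_suml ler_sum // => k _.
by rewrite -mulr_sumr ler_wpM2l ?normc_ge0.
Qed.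

End EntryNorm.

(** * Equivalence of an arbitrary matrix norm with the entrywise norm *)

Section MatrixNorm.
Variables (R : realType) (n : nat) (N : 'M[R[i]]_n -> R).
Hypothesis N_norm : is_matrix_norm N.
Implicit Types E F : 'M[R[i]]_n.

Lemma matrix_normZ_normc (a : R[i]) E : N (a *: E) = normc a * N E.
Proof. by apply: complexI; rewrite (matrix_normZ N_norm) rmorphM. Qed.

Lemma matrix_norm0 : N 0 = 0.
Proof. by rewrite -(scale0r (0 : 'M_n)) matrix_normZ_normc normc0 mul0r. Qed.

Lemma matrix_normN E : N (- E) = N E.
Proof. by rewrite -scaleN1r matrix_normZ_normc normcN normc1 mul1r. Qed.

Lemma matrix_norm_ge0 E : 0 <= N E.
Proof.
have := matrix_normD N_norm E (- E).
by rewrite matrix_normN subrr matrix_norm0 -mulr2n pmulrn_lge0.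
Qed.

Lemma matrix_norm_sum (I : finType) (F : I -> 'M[R[i]]_n) :
  N (\sum_i F i) <= \sum_i N (F i).
Proof.
elim/big_ind2: _ => [|u a v c ua vc|//]; first by rewrite matrix_norm0.
by rewrite (le_trans (matrix_normD N_norm _ _)) ?lerD.
Qed.

Lemma matrix_norm_le_entry_norm :
  exists2 C : R, 0 < C & forall E, N E <= C * entry_norm E.
Proof.
(* [C] dominates the norm of every matrix unit, and the 1 makes it positive for n = 0 as well. *)
pose C := 1 + \sum_i \sum_j N (delta_mx i j).
have sum_ge0 i : 0 <= \sum_j N (delta_mx i j).
  by apply: sumr_ge0 => j _; exact: matrix_norm_ge0.
have C_ge i j : N (delta_mx i j) <= C.
  rewrite /C (bigD1 i) //= (bigD1 j) //= addrCA -addrA lerDl.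
  rewrite !addr_ge0 ?sumr_ge0 // => *; exact: matrix_norm_ge0.
exists C => [|E]; first by rewrite ltr_pwDl ?sumr_ge0.
rewrite {1}[E]matrix_sum_delta (le_trans (matrix_norm_sum _)) // mulr_sumr.
apply: ler_sum => i _; rewrite (le_trans (matrix_norm_sum _)) // mulr_sumr.
apply: ler_sum => j _; rewrite matrix_normZ_normc mulrC.
by rewrite ler_wpM2r ?normc_ge0.
Qed.

(** Real and imaginary parts are laid side by side in one real row, the setting in which the
    compactness argument of [rV_norm_lower_bound] is carried out. *)
Definition complex_mx_of_rV (v : 'rV[R]_(n * n + n * n)) : 'M[R[i]]_n :=
  \matrix_(i, j) (vec_mx (lsubmx v) i j +i* vec_mx (rsubmx v) i j).

Definition rV_of_complex_mx E : 'rV[R]_(n * n + n * n) :=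
  row_mx (mxvec (map_mx (@complex.Re R) E)) (mxvec (map_mx (@complex.Im R) E)).

Lemma complex_mx_of_rVK : cancel complex_mx_of_rV rV_of_complex_mx.
Proof.
move=> v; rewrite -[RHS]hsubmxK -[lsubmx v]vec_mxK -[rsubmx v]vec_mxK.
by congr (row_mx (mxvec _) (mxvec _)); apply/matrixP => i j; rewrite !mxE.
Qed.

Lemma rV_of_complex_mxK : cancel rV_of_complex_mx complex_mx_of_rV.
Proof.
move=> E; apply/matrixP => i j.
by rewrite mxE row_mxKl row_mxKr !mxvecK !mxE; case: (E i j).
Qed.

Lemma entry_norm_le_matrix_norm :
  exists2 C : R, 0 < C & forall E, entry_norm E <= C * N E.
Proof.
have [v|a v|u v|c c_gt0 c_le] :=
    @rV_norm_lower_bound R (n * n + n * n) (N \o complex_mx_of_rV).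
- move/(matrix_norm_eq0 N_norm) => v0; rewrite -[v]complex_mx_of_rVK v0.
  by rewrite /rV_of_complex_mx !raddf0 row_mx0.
- rewrite /= -normc_real -matrix_normZ_normc; congr N.
  by apply/matrixP => i j; rewrite !mxE; simpc.
- rewrite /= (le_trans _ (matrix_normD N_norm _ _)) //.
  rewrite le_eqVlt; apply/orP; left; apply/eqP; congr N.
  by apply/matrixP => i j; rewrite !mxE; simpc.
(* Each of the n^2 entries has real and imaginary parts bounded by c * N E, whence c + c per
   entry. *)
exists (1 + \sum_(i < n) \sum_(j < n) (c + c)) => [|E].
  rewrite ltr_pwDl //; apply: sumr_ge0 => i _; apply: sumr_ge0 => j _.
  by rewrite addr_ge0 ?ltW.
rewrite mulrDl mul1r ler_wpDl ?matrix_norm_ge0 // mulr_suml ler_sum // => i _.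
rewrite mulr_suml ler_sum // => j _; rewrite (le_trans (normc_le_ReD_Im _)) //.
have := c_le (rV_of_complex_mx E); rewrite /= rV_of_complex_mxK mulrDl => vE.
apply: lerD; apply: le_trans vE.
  have := rV_entry_le_norm (rV_of_complex_mx E) (lshift _ (mxvec_index i j)).
  by rewrite row_mxEl mxvecE mxE.
have := rV_entry_le_norm (rV_of_complex_mx E) (rshift _ (mxvec_index i j)).
by rewrite row_mxEr mxvecE mxE.
Qed.

End MatrixNorm.

(** * Calculus of orders of vanishing at 0 *)

(** F E = O(|E|^k), with one constant on the whole unit ball. On that ball higher powers of |E| are
    smaller, so an order can always be lowered, and orders add under products without any limit
    argument. *)
Definition entry_bigO (R : realType) (n k : nat)
    (F : 'M[R[i]]_n -> 'M[R[i]]_n) : Prop :=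
  exists2 K : R, 0 <= K &
    forall E, entry_norm E <= 1 -> entry_norm (F E) <= K * entry_norm E ^+ k.

Section EntryBigO.
Variables (R : realType) (n : nat).
Implicit Types F G : 'M[R[i]]_n -> 'M[R[i]]_n.

Lemma eq_entry_bigO k F G : F =1 G -> entry_bigO k F -> entry_bigO k G.
Proof. by move=> FG [K K0 FK]; exists K => // E E1; rewrite -FG FK. Qed.

Lemma entry_bigO_cst (A : 'M[R[i]]_n) : entry_bigO 0 (fun=> A).
Proof.
by exists (entry_norm A) => [|E _]; rewrite ?expr0 ?mulr1 ?entry_norm_ge0.
Qed.

Lemma entry_bigO_id : entry_bigO 1 (@id 'M[R[i]]_n).
Proof. by exists 1 => // E _; rewrite mul1r. Qed.

Lemma entry_bigO_trC k F : entry_bigO k F -> entry_bigO k (fun E => (F E) ^t*).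
Proof. by move=> [K K0 FK]; exists K => // E E1; rewrite entry_norm_trC FK. Qed.

Lemma entry_bigO_weak k l F : (l <= k)%N -> entry_bigO k F -> entry_bigO l F.
Proof.
move=> lk [K K0 FK]; exists K => // E E1; rewrite (le_trans (FK _ E1)) //.
by rewrite ler_wpM2l // ler_wiXn2l ?entry_norm_ge0.
Qed.

Lemma entry_bigOD k F G :
  entry_bigO k F -> entry_bigO k G -> entry_bigO k (fun E => F E + G E).
Proof.
move=> [K K0 FK] [H H0 GH]; exists (K + H) => [|E E1]; first exact: addr_ge0.
by rewrite (le_trans (entry_normD _ _)) // mulrDl lerD ?FK ?GH.
Qed.

Lemma entry_bigOZ k (a : R[i]) F :
  entry_bigO k F -> entry_bigO k (fun E => a *: F E).
Proof.
move=> [K K0 FK]; exists (normc a * K) => [|E E1].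
  by rewrite mulr_ge0 ?normc_ge0.
by rewrite entry_normZ -mulrA ler_wpM2l ?normc_ge0 ?FK.
Qed.

Lemma entry_bigON k F : entry_bigO k F -> entry_bigO k (fun E => - F E).
Proof.
by move/(entry_bigOZ (-1)); apply: eq_entry_bigO => E; rewrite scaleN1r.
Qed.

Lemma entry_bigOM k l F G : entry_bigO k F -> entry_bigO l G ->
  entry_bigO (k + l) (fun E => F E *m G E).
Proof.
move=> [K K0 FK] [H H0 GH]; exists (K * H) => [|E E1]; first exact: mulr_ge0.
rewrite (le_trans (entry_normM _ _)) // exprD mulrACA.
by rewrite ler_pM ?entry_norm_ge0 ?FK ?GH.
Qed.

Lemma entry_bigO_exp k F p :
  entry_bigO k F -> entry_bigO (k * p) (fun E => F E ^+ p).
Proof.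
move=> FO; elim: p => [|p IHp].
  by rewrite muln0; exact: entry_bigO_cst.
rewrite mulnS; apply: eq_entry_bigO (entry_bigOM FO IHp) => E.
by rewrite exprS mulmxE.
Qed.

Lemma entry_bigO0 k : entry_bigO k (fun=> 0 : 'M[R[i]]_n).
Proof.
exists 0 => // E _; rewrite mul0r -(scale0r (0 : 'M_n)) entry_normZ.
by rewrite normc0 mul0r.
Qed.

Lemma entry_bigO_sum k (I : eqType) (r : seq I)
    (F : I -> 'M[R[i]]_n -> 'M[R[i]]_n) :
  (forall i, i \in r -> entry_bigO k (F i)) ->
  entry_bigO k (fun E => \sum_(i <- r) F i E).
Proof.
elim: r => [|i r IHr] FO.
  by apply: eq_entry_bigO (entry_bigO0 k) => E; rewrite big_nil.
have Or : entry_bigO k (fun E => \sum_(i <- r) F i E).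
  by apply: IHr => j jr; apply: FO; rewrite inE jr orbT.
apply: eq_entry_bigO (entry_bigOD (FO i (mem_head _ _)) Or) => E.
by rewrite big_cons.
Qed.

End EntryBigO.

(** * Uniqueness of the derivative and a quadratic-remainder criterion *)

Section Frechet.
Variables (R : realType) (n : nat) (N : 'M[R[i]]_n -> R).
Hypothesis N_norm : is_matrix_norm N.
Implicit Types f L : 'M[R[i]]_n -> 'M[R[i]]_n.

Lemma real_linearZ L (a : R) E : real_linear L -> L (a%:C *: E) = a%:C *: L E.
Proof.
move=> L_lin; have L0 : L 0 = 0.
  have /eqP := L_lin 1 0 0.
  by rewrite scaler0 addr0 scale1r -subr_eq0 opprD addNKr oppr_eq0 => /eqP.
by rewrite -[a%:C *: E]addr0 L_lin L0 addr0.
Qed.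

(** Both maps approximate the same increment, so they differ by o(t) at t E; real homogeneity
    divides t out, leaving a bound by every e > 0. *)
Lemma is_frechet_unique f X L1 L2 :
  is_frechet N f X L1 -> is_frechet N f X L2 -> L1 = L2.
Proof.
move=> [L1_lin L1P] [L2_lin L2P]; apply: funext => E.
apply/eqP; rewrite -subr_eq0; apply/eqP/(matrix_norm_eq0 N_norm)/eqP.
rewrite eq_le matrix_norm_ge0 // andbT; apply/ler_addgt0Pl => e e_gt0.
have NE1 : 0 < 1 + N E by rewrite ltr_pwDl ?matrix_norm_ge0.
(* The two errors add up to 2 e' t N E = t e N E / (1 + N E) <= t e; writing 1 + N E avoids a
   division by zero when E = 0. *)
pose e' := e / (1 + N E) / 2.
have e'_gt0 : 0 < e' by rewrite !divr_gt0.
have [d1 d1_gt0 d1P] := L1P _ e'_gt0.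
have [d2 d2_gt0 d2P] := L2P _ e'_gt0.
pose t := Num.min d1 d2 / (1 + N E).
have t_gt0 : 0 < t by rewrite divr_gt0 // lt_min d1_gt0.
have NtE : N (t%:C *: E) = t * N E.
  by rewrite matrix_normZ_normc // normc_real gtr0_norm.
have : N (t%:C *: E) < Num.min d1 d2.
  rewrite NtE mulrAC ltr_pdivrMr // ltr_pM2l ?lt_min ?d1_gt0 //.
  by rewrite ltrDr.
rewrite lt_min => /andP[/d1P H1 /d2P H2].
have : N (t%:C *: (L1 E - L2 E)) <= e' * N (t%:C *: E) + e' * N (t%:C *: E).
  rewrite (le_trans _ (lerD H2 H1)) // scalerBr.
  rewrite -(real_linearZ _ _ L1_lin) -(real_linearZ _ _ L2_lin).
  move: (f _ - _) => A; rewrite -[in leRHS](matrix_normN N_norm (A - L1 _)).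
  rewrite (le_trans _ (matrix_normD N_norm _ _)) //.
  by rewrite opprB [X in _ <= N X]addrC addrA subrK.
rewrite (matrix_normZ_normc N_norm) normc_real gtr0_norm // NtE.
rewrite mulrCA -mulrDr ler_pM2l // -mulrDl -splitr => H.
by rewrite addr0 (le_trans H) // mulrAC ler_pdivrMr // ler_pM2l // ltW ?ltrDr.
Qed.

Lemma is_frechet_entry_bigO f X L : real_linear L ->
  entry_bigO 2 (fun E => f (X + E) - f X - L E) -> is_frechet N f X L.
Proof.
move=> L_lin [K K_ge0 KP]; split=> // e e_gt0.
have [C C_gt0 CP] := matrix_norm_le_entry_norm N_norm.
have [c c_gt0 cP] := entry_norm_le_matrix_norm N_norm.
pose M := 1 + C * K * c ^+ 2.
have M_gt0 : 0 < M by rewrite ltr_pwDl // mulr_ge0 ?exprn_ge0 ?mulr_ge0 // ltW.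
(* The first bound puts E in the unit ball of [entry_norm]; the second turns the quadratic bound M
   (N E)^2 into e * N E. *)
exists (Num.min c^-1 (e / M)) => [|E].
  by rewrite lt_min invr_gt0 c_gt0 divr_gt0.
rewrite lt_min ltr_pdivlMr // => /andP[NE_c NE_e].
have NE_ge0 := matrix_norm_ge0 N_norm E.
have E1 : entry_norm E <= 1.
  by rewrite (le_trans (cP E)) // -ler_pdivlMl // mulr1 ltW.
rewrite (le_trans (CP _)) //.
apply: (@le_trans _ _ (C * (K * (c * N E) ^+ 2))).
  rewrite ler_pM2l // (le_trans (KP _ E1)) // ler_wpM2l //.
  by rewrite lerXn2r ?nnegrE ?entry_norm_ge0 ?mulr_ge0 // ltW.
rewrite exprMn expr2 !mulrA -[_ * c * c]mulrA -[c * c]expr2 ler_wpM2r //.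
by rewrite (le_trans _ (ltW NE_e)) // mulrC ler_wpM2l // /M lerDr.
Qed.

Lemma frechetE f X L : is_frechet N f X L -> frechet N f X = L.
Proof.
move=> fL; rewrite /frechet; case: xgetP => [L' _ fL'|/(_ L)//].
exact: is_frechet_unique fL' fL.
Qed.

End Frechet.

(** * Algebra of the conjugate transpose *)

Section ConjugateTranspose.
Variables (R : realType) (n : nat).
Implicit Types A B : 'M[R[i]]_n.

Lemma trmxCK A : A ^t* ^t* = A.
Proof. by apply/matrixP => i j; rewrite !mxE conjCK. Qed.

Lemma trmxCD A B : (A + B) ^t* = A ^t* + B ^t*.
Proof. by apply/matrixP => i j; rewrite !mxE rmorphD. Qed.

Lemma trmxCN A : (- A) ^t* = - A ^t*.
Proof. by apply/matrixP => i j; rewrite !mxE rmorphN. Qed.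

Lemma trmxCM A B : (A *m B) ^t* = B ^t* *m A ^t*.
Proof. by rewrite trmx_mul map_mxM. Qed.

Lemma trmxCZ (a : R) A : (a%:C *: A) ^t* = a%:C *: A ^t*.
Proof.
apply/matrixP => i j; rewrite !mxE rmorphM; congr (_ * _); exact: conjc_real.
Qed.

End ConjugateTranspose.

(** * Expansion of the iteration map at a fixed point *)

Definition g_derivative (R : realType) (n : nat) (S Z E : 'M[R[i]]_n) :
    'M[R[i]]_n :=
  2^-1 *: (E - Z *m E ^t* *m S *m Z).

Section FixedPoint.
Variables (R : realType) (n : nat) (S Z : 'M[R[i]]_n).
Implicit Types E : 'M[R[i]]_n.

Lemma g_derivative_real_linear : real_linear (g_derivative S Z).
Proof.
move=> a E F; rewrite /g_derivative.
rewrite trmxCD trmxCZ.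
rewrite !mulmxDr !mulmxDl -!scalemxAr -!scalemxAl opprD addrACA -scalerBr.
by rewrite scalerDr !scalerA mulrC.
Qed.

Lemma g_derivative_bounded (N : 'M[R[i]]_n -> R) : is_matrix_norm N ->
  exists c : R, forall E, N (g_derivative S Z E) <= c * N E.
Proof.
move=> N_norm.
have [C C_gt0 CP] := matrix_norm_le_entry_norm N_norm.
have [c c_gt0 cP] := entry_norm_le_matrix_norm N_norm.
pose M := entry_norm Z * entry_norm S * entry_norm Z.
have M_ge0 : 0 <= M by rewrite !mulr_ge0 ?entry_norm_ge0.
pose K := C * (normc (2^-1 : R[i]) * (1 + M)).
exists (K * c) => E; apply: (@le_trans _ _ (K * entry_norm E)); last first.
  by rewrite -[leRHS]mulrA ler_wpM2l // !mulr_ge0 ?normc_ge0 ?addr_ge0 // ltW.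
rewrite (le_trans (CP _)) // /K -mulrA ler_pM2l // entry_normZ -mulrA.
rewrite ler_wpM2l ?normc_ge0 // mulrDl mul1r (le_trans (entry_normD _ _)) //.
rewrite lerD2l -scaleN1r entry_normZ normcN normc1 mul1r.
rewrite (le_trans (entry_normM _ _)) // /M mulrAC ler_wpM2r ?entry_norm_ge0 //.
rewrite (le_trans (entry_normM _ _)) // mulrAC ler_wpM2r ?entry_norm_ge0 //.
by rewrite (le_trans (entry_normM _ _)) // entry_norm_trC.
Qed.

Lemma b1E : b R 1 = 2^-1.
Proof. by rewrite /= !mulr1 -addrA subrr addr0 div1r. Qed.

Hypothesis ZSZ : Z ^t* *m S *m Z = 1%:M.

(** The hypothesis makes Z^* S a left inverse of the square matrix Z, hence also a right inverse. *)
Lemma mulmx_ZZS : Z *m (Z ^t* *m S) = 1%:M.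
Proof. exact: mulmx1C. Qed.

Lemma g_fixed m : g S m Z = Z.
Proof.
rewrite /g ZSZ subrr big_ltn // big1_seq ?addr0 => [|k].
  by rewrite scale1r mulmx1.
rewrite mem_index_iota => /andP[_ /andP[k_gt0 _]].
by rewrite expr0n gtn_eqF ?scaler0.
Qed.

Lemma defectE E : 1%:M - (Z + E) ^t* *m S *m (Z + E) =
  - (E ^t* *m S *m Z + Z ^t* *m S *m E + E ^t* *m S *m E).
Proof.
rewrite trmxCD !mulmxDl !mulmxDr ZSZ !opprD !addrA subrr sub0r.
by congr (_ - _); rewrite addrC.
Qed.

Lemma entry_bigO_defect :
  entry_bigO 1 (fun E => 1%:M - (Z + E) ^t* *m S *m (Z + E)).
Proof.
have O1 := entry_bigO_id R n; have Ot := entry_bigO_trC O1.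
have Oc (A : 'M[R[i]]_n) := entry_bigO_cst A.
have O := entry_bigON (entry_bigOD (entry_bigOD
  (entry_bigOM (entry_bigOM Ot (Oc S)) (Oc Z))
  (entry_bigOM (Oc (Z ^t* *m S)) O1))
  (* The term E^* S E has order 2 and is lowered to order 1 to match the linear terms. *)
  (entry_bigO_weak (leqnSn 1) (entry_bigOM (entry_bigOM Ot (Oc S)) O1))).
by apply: eq_entry_bigO O => E; rewrite defectE.
Qed.

(** The condition m >= 1 ensures that the k = 1 term is present; its part Z D / 2 contributes -(E +
    Z E^* S Z) / 2, which together with the E from k = 0 gives exactly the derivative. *)
Lemma g_remainderE m E : (1 <= m)%N ->
  let D := 1%:M - (Z + E) ^t* *m S *m (Z + E) in
  g S m (Z + E) - g S m Z - g_derivative S Z E =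
    2^-1 *: (E *m D - Z *m (E ^t* *m S *m E)) +
    (Z + E) *m \sum_(2 <= k < m.+1) b R k *: D ^+ k.
Proof.
move=> m_ge1 D; rewrite g_fixed /g -/D big_ltn // big_ltn // b1E expr0 expr1.
set T := E ^t* *m S *m E.
have ZD : Z *m D = - (Z *m E ^t* *m S *m Z + E + Z *m T).
  rewrite /D defectE mulmxN !mulmxDr; congr (- (_ + _ + _)).
    by rewrite !mulmxA.
  by rewrite mulmxA mulmx_ZZS mul1mx.
rewrite /= scale1r addrA mulmxDr mulmxDr mulmx1 -scalemxAr (mulmxDl Z E D) ZD.
(* With the matrix products abstracted, what remains is a linear identity, checked entry by
   entry. *)
rewrite /g_derivative; move: (_ *m \sum_(_ <= _ < _) _) (E *m D) (Z *m T).
move=> X Y W; move: (Z *m _ *m _ *m _) => V.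
by apply/matrixP => i j; rewrite !mxE; field.
Qed.

Lemma g_is_frechet (N : 'M[R[i]]_n -> R) (m : nat) : is_matrix_norm N ->
  (1 <= m)%N -> is_frechet N (g S m) Z (g_derivative S Z).
Proof.
move=> N_norm m_ge1; apply: is_frechet_entry_bigO => //.
  exact: g_derivative_real_linear.
have O1 := entry_bigO_id R n; have Ot := entry_bigO_trC O1.
have Oc (A : 'M[R[i]]_n) := entry_bigO_cst A; have OD := entry_bigO_defect.
have Otail : entry_bigO 2 (fun E => \sum_(2 <= k < m.+1)
    b R k *: (1%:M - (Z + E) ^t* *m S *m (Z + E)) ^+ k).
  (* D has order 1, so D^k has order k >= 2. *)
  apply: entry_bigO_sum => k; rewrite mem_index_iota => /andP[k_ge2 _].
  apply: entry_bigOZ; apply: entry_bigO_weak k_ge2 _.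
  by have := entry_bigO_exp k OD; rewrite mul1n.
have OZE := entry_bigOD (Oc Z) (entry_bigO_weak (leq0n 1) O1).
have O := entry_bigOD
  (entry_bigOZ 2^-1 (entry_bigOD (entry_bigOM O1 OD)
    (entry_bigON (entry_bigOM (Oc Z) (entry_bigOM (entry_bigOM Ot (Oc S)) O1)))))
  (entry_bigOM OZE Otail).
by apply: eq_entry_bigO O => E; rewrite g_remainderE.
Qed.

Hypothesis S_herm : S ^t* = S.

Lemma g_derivative_idem E :
  g_derivative S Z (g_derivative S Z E) = g_derivative S Z E.
Proof.
pose P F := Z *m F ^t* *m S *m Z.
have PP : P (P E) = E.
  rewrite /P !trmxCM S_herm trmxCK -(mulmxA _ S Z) !mulmxA -[Z *m _ *m S]mulmxA.
  by rewrite mulmx_ZZS mul1mx -!mulmxA (mulmxA (Z ^t*)) ZSZ mulmx1.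
(* P is conjugate-linear, and the factor 1/2 passes through it because it is real. *)
have PB F H : P (2^-1 *: (F - H)) = 2^-1 *: (P F - P H).
  rewrite /P; have -> : 2^-1 = (2^-1)%:C :> R[i] by rewrite fmorphV rmorphMn.
  rewrite trmxCZ trmxCD trmxCN -!scalemxAr -!scalemxAl.
  by rewrite mulmxBr !mulmxBl.
rewrite {1}/g_derivative -/(P _) {2}/g_derivative -/(P _) PB PP.
(* With L for the derivative, P (L E) = (P E - E) / 2 = - L E, so L (L E) = (L E + L E) / 2 = L
   E. *)
rewrite -(opprB E) scalerN opprK -/(g_derivative S Z E).
rewrite -(mulr2n (g_derivative S Z E)).
rewrite -(scaler_nat 2 (g_derivative S Z E)) scalerA.
by rewrite mulVf ?pnatr_eq0 ?scale1r.
Qed.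

End FixedPoint.

Theorem mainTheorem4 (R : realType) (n : nat) (N : 'M[R[i]]_n -> R)
    (N_norm : is_matrix_norm N) (S : 'M[R[i]]_n) (S_hpd : hermitian_posdef S)
    (m : nat) (m_ge1 : (1 <= m)%N) (Z : 'M[R[i]]_n)
    (ZSZ : Z ^t* *m S *m Z = 1%:M) :
  [/\ Z = g S m Z,
      frechet_differentiable N (g S m) Z,
      forall E : 'M[R[i]]_n,
        frechet N (g S m) Z E = 2^-1 *: (E - Z *m E ^t* *m S *m Z),
      forall E : 'M[R[i]]_n,
        frechet N (g S m) Z (frechet N (g S m) Z E) = frechet N (g S m) Z E &
      stable_iteration N (g S m) Z].
Proof.
have gL := g_is_frechet ZSZ N_norm m_ge1.
have gE := frechetE N_norm gL.
have S_herm : S ^t* = S.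
  case: S_hpd => /sesquilinear.is_hermitianmxP S_eq _.
  by rewrite [RHS]S_eq expr0 scale1r.
have g_idem := g_derivative_idem ZSZ S_herm.
have g_diff : frechet_differentiable N (g S m) Z by exists (g_derivative S Z).
have g_fix := g_fixed ZSZ m.
split=> [|//|E|E|]; rewrite ?gE; [by []|by []|exact: g_idem|].
split=> //.
have [c cP] := g_derivative_bounded S Z N_norm.
(* By idempotence every iterate with p > 0 equals the derivative itself, so its operator bound [c]
   serves for all p. *)
exists c => -[//|p] _ E E_neq0; rewrite gE iterSr.
have -> : iter p (g_derivative S Z) (g_derivative S Z E) = g_derivative S Z E.
  by elim: p => [//|p IHp]; rewrite iterS IHp g_idem.
rewrite ler_pdivrMr ?cP // lt0r matrix_norm_ge0 // andbT.
by apply: contra_neq E_neq0; exact: matrix_norm_eq0.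
Qed.
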